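(* Let $\mathcal{H}$ be a separable infinite-dimensional Hilbert space and let $\{f_n\}_{n=0}^{\infty}\subseteq\mathcal{H}$ be an unconditional Schauder basis of $\mathcal{H}$. (1) $\{f_n\}_{n=0}^{\infty}$ is not a CFC sequence if and only if $\lim_{n\to\infty}\|f_n\|=0$. (2) The following are equivalent: (a) $\{f_n\}_{n=0}^{\infty}$ is a CO sequence; (b) $\{f_n\}_{n=0}^{\infty}$ is an ICO sequence; (c) $\inf_n\|f_n\|>0$. (3) The following are equivalent: (a) $\{f_n\}_{n=0}^{\infty}$ is an SCO sequence; (b) $\{f_n\}_{n=0}^{\infty}$ is a Riesz basis of $\mathcal{H}$.
   Context: $\{f_n\}\subseteq\mathcal{H}$ is an unconditional Schauder basis of $\mathcal{H}$ if there is $\{g_n\}\subseteq\mathcal{H}$ with $\langle f_n,g_k\rangle=\delta_{nk}$ and $f=\sum_n\langle f,g_n\rangle f_n$ with unconditional norm convergence for every $f\in\mathcal{H}$. A sequence $\{h_n\}$ is a frame for $\mathcal{H}$ if there are $A,B>0$ with $A\|f\|^2\le\sum_n|\langle f,h_n\rangle|^2\le B\|f\|^2$ for all $f\in\mathcal{H}$, and a Parseval frame if $\sum_n|\langle f,h_n\rangle|^2=\|f\|^2$ for all $f\in\mathcal{H}$. A Riesz basis is a frame $\{f_n\}$ for which there is $\{g_n\}\subseteq\mathcal{H}$ with $\langle f_n,g_k\rangle=\delta_{nk}$ (equivalently, the image of an orthonormal basis under a bounded invertible operator). $\{f_n\}_{n=0}^\infty$ is a CFC sequence if there is $B\in B(\mathcal{H})$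 (a bounded linear operator on $\mathcal{H}$) such that $\{Bf_n\}$ is a Parseval frame in $\mathcal{H}$. It is a CO sequence if there is $B\in B(\mathcal{H})$ such that $\{Bf_n\}$ is an orthonormal basis of $\mathcal{H}$; it is an ICO (respectively SCO) sequence if such a $B$ (making $\{Bf_n\}$ an orthonormal basis) can be chosen injective (respectively surjective). *)

(* Defs.v *)
From HB Require Import structures.
From mathcomp Require Import all_boot all_order all_algebra.
From mathcomp Require Import sesquilinear complex.
From mathcomp Require Import all_classical all_reals all_analysis.

Set Implicit Arguments.
Unset Strict Implicit.
Unset Printing Implicit Defensive.

Import Order.TTheory GRing.Theory Num.Theory.
Import numFieldNormedType.Exports.

Local Open Scope classical_set_scope.
Local Open Scope ring_scope.

(* Real and complex Hilbert spaces are treated uniformly: [k] selects the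
   scalar field, together with its conjugation and its real part. *)
Variant scalar_kind := RealScalars | ComplexScalars.

Definition scalars (R : realType) (k : scalar_kind) : numFieldType :=
  match k with
  | RealScalars => R
  | ComplexScalars => R[i]
  end.

Definition conjs (R : realType) (k : scalar_kind) :
    scalars R k -> scalars R k :=
  match k return scalars R k -> scalars R k with
  | RealScalars => fun z : R => z
  | ComplexScalars => fun z : R[i] => conjc z
  end.
Arguments conjs : clear implicits.

Definition res (R : realType) (k : scalar_kind) : scalars R k -> R :=
  match k return scalars R k -> R with
  | RealScalars => fun z : R => z
  | ComplexScalars => fun z : R[i] => complex.Re z
  end.

(* The norms of the library take their values in the scalar field (as
   nonnegative, hence real, elements); these are the same norms valued in R. *)
Definition absR (R : realType) (k : scalar_kind) (z : scalars R k) : R :=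
  res `|z|.

Definition normR (R : realType) (k : scalar_kind)
    (H : normedModType (scalars R k)) (x : H) : R :=
  res `|x|.

Definition separable_space (T : topologicalType) : Prop :=
  exists2 D : set T, countable D & dense D.

Definition finite_dimensional (K : pzRingType) (V : lmodType K) : Prop :=
  exists (n : nat) (e : 'I_n -> V),
    forall x, exists c : 'I_n -> K, x = \sum_(i < n) c i *: e i.

Definition unconditionally_cvg_to (K : numFieldType) (V : normedModType K)
    (u : nat -> V) (l : V) : Prop :=
  series u @ \oo --> l /\
  forall s : nat -> nat, bijective s -> cvgn (series (u \o s)).

Section HilbertSpace.
Variables (R : realType) (k : scalar_kind).
Variable H : completeNormedModType (scalars R k).
(* [{dot H for conjs R k}] is the type of positive definite forms that are
   linear in the first argument and conjugate-linear in the second one. *)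
Variable ip : {dot H for conjs R k}.

Definition ip_induces_norm : Prop := forall x : H, ip x x = `|x| ^+ 2.

Definition biorthogonal (f g : nat -> H) : Prop :=
  forall n m, ip (f n) (g m) = (n == m)%:R.

Definition unconditional_Schauder_basis (f : nat -> H) : Prop :=
  exists2 g : nat -> H, biorthogonal f g &
    forall x, unconditionally_cvg_to (fun n => ip x (g n) *: f n) x.

Definition coef_sqsum (h : nat -> H) (x : H) : \bar R :=
  (\sum_(0 <= n <oo) ((absR (ip x (h n))) ^+ 2)%:E)%E.

Definition frame (h : nat -> H) : Prop :=
  exists A B : R, [/\ 0 < A, 0 < B &
    forall x, ((A * normR x ^+ 2)%:E <= coef_sqsum h x)%E /\
              (coef_sqsum h x <= (B * normR x ^+ 2)%:E)%E].

Definition Parseval_frame (h : nat -> H) : Prop :=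
  forall x, coef_sqsum h x = (normR x ^+ 2)%:E.

Definition Riesz_basis (f : nat -> H) : Prop :=
  frame f /\ exists g : nat -> H, biorthogonal f g.

Definition orthonormal_basis (e : nat -> H) : Prop :=
  biorthogonal e e /\
  forall x, series (fun n => ip x (e n) *: e n) @ \oo --> x.

Definition bounded_operator (B : {linear H -> H}) : Prop :=
  exists M : R, forall x, normR (B x) <= M * normR x.

Definition CFC (f : nat -> H) : Prop :=
  exists B : {linear H -> H}, bounded_operator B /\ Parseval_frame (B \o f).

Definition CO (f : nat -> H) : Prop :=
  exists B : {linear H -> H}, bounded_operator B /\ orthonormal_basis (B \o f).

Definition ICO (f : nat -> H) : Prop :=
  exists B : {linear H -> H},
    [/\ bounded_operator B, injective B & orthonormal_basis (B \o f)].

Definition SCO (f : nat -> H) : Prop :=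
  exists B : {linear H -> H},
    [/\ bounded_operator B, (forall y, exists x, B x = y) &
        orthonormal_basis (B \o f)].

End HilbertSpace.

(* Main.v *)
Require Import Defs.
From HB Require Import structures.
From mathcomp Require Import all_boot all_order all_algebra.
From mathcomp Require Import sesquilinear complex.
From mathcomp Require Import all_classical all_reals all_analysis.
From mathcomp Require Import ring lra zify.

Set Implicit Arguments.
Unset Strict Implicit.
Unset Printing Implicit Defensive.

Import Order.TTheory GRing.Theory Num.Theory.
Import numFieldNormedType.Exports.

Local Open Scope classical_set_scope.
Local Open Scope ring_scope.

(** Everything rests on the theorem of Koethe and Toeplitz: in a Hilbert space
    an unconditional basis [f] with coefficient functionals [<.,g_n>] satisfies
    [|x|^2 ~ sum_n |<x,g_n>|^2 |f_n|^2] up to constants ([Kothe_Toeplitz]).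
    Unconditionality first yields a uniform bound for the projections
    [x |-> sum_(n in A) <x,g_n> f_n] ([mask_bound]): if there were none, a
    gliding hump would produce a vector whose expansion has a divergent
    rearrangement. Hence sign changes are uniformly bounded, and the
    parallelogram identity shows that for suitable signs the squared norm of
    [sum +-c_n f_n] is at most, or at least, [sum |c_n f_n|^2].

    This equivalence turns the three statements into statements on the weights
    [|f_n|], with a fixed orthonormal basis [e] obtained from [f].

    If [|f_n|] is bounded below, [sum <x,g_n> f_n |-> sum <x,g_n> e_n] is
    bounded ([basis_extension]), and it is injective because it preserves
    coefficients; conversely [1 = |B f_n| <= M |f_n|].

    If [|f_n|] does not tend to zero, the same construction on an infinite set
    of indices where it is bounded below, with zero elsewhere, gives a Parseval
    frame. If [|f_n|] tends to zero, the synthesis operator of [(B f_n)] is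
    compact, which no Parseval frame of an infinite-dimensional space allows.

    Finally, an operator sending [f] to an orthonormal basis is onto exactly
    when every square summable sequence can be synthesised in [f], that is when
    [|f_n|] is bounded above as well as below; and these two bounds are
    equivalent to the two frame inequalities. *)

(** * Scalars *)

Section Scalars.
Variables (R : realType) (k : scalar_kind).
Local Notation K := (scalars R k).

(** The norm of a vector is a nonnegative scalar, and [res] sends it to [R];
    [emb] goes back. It turns each fact about the norm or the inner product
    into one about real numbers, the same way for both scalar fields. *)
Definition emb : R -> K :=
  match k return R -> scalars R k with
  | RealScalars => fun a : R => a
  | ComplexScalars => fun a : R => (real_complex R a : R[i])
  end.
End Scalars.
Arguments emb {R k}.

Section ScalarTheory.
Variables (R : realType) (k : scalar_kind).
Local Notation K := (scalars R k).

Lemma embK : cancel (@emb R k) (@res R k).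
Proof. by case: k. Qed.

Lemma embD a b : emb (a + b) = emb a + emb b :> K.
Proof. by case: k => //=; rewrite rmorphD. Qed.

Lemma embM a b : emb (a * b) = emb a * emb b :> K.
Proof. by case: k => //=; rewrite rmorphM. Qed.

Lemma emb0 : emb 0 = 0 :> K.
Proof. by case: k => //=; rewrite rmorph0. Qed.

Lemma emb1 : emb 1 = 1 :> K.
Proof. by case: k => //=; rewrite rmorph1. Qed.

Lemma emb_le a b : (emb a <= emb b :> K) = (a <= b).
Proof. by case: k => //=; rewrite lecR. Qed.

Lemma emb_lt a b : (emb a < emb b :> K) = (a < b).
Proof. by case: k => //=; rewrite ltcR. Qed.

Lemma emb_ge0P (z : K) : 0 <= z -> z = emb (res z).
Proof.
move: z; case: k => //= z; case: z => a b.
by rewrite lecE /= => /andP[/eqP -> _].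
Qed.

Lemma embX a n : emb (a ^+ n) = emb a ^+ n :> K.
Proof. by elim: n => [|n IH]; rewrite ?emb1// !exprS embM IH. Qed.

Lemma resD (y z : K) : res (y + z) = res y + res z.
Proof. by move: y z; case: k => //= -[a b] [c d]. Qed.

Lemma resN (z : K) : res (- z) = - res z.
Proof. by move: z; case: k => //= -[a b]. Qed.

Lemma res_emb_mul a (z : K) : res (emb a * z) = a * res z.
Proof. by move: z; case: k => //= -[c d] /=; rewrite mul0r subr0. Qed.

Lemma conjsD : {morph conjs R k : y z / y + z}.
Proof. by case: k => //= y z; rewrite rmorphD. Qed.

Lemma conjsM : {morph conjs R k : y z / y * z}.
Proof. by case: k => //= y z; rewrite rmorphM. Qed.

Lemma conjsK : involutive (conjs R k).
Proof. by case: k => //= z; rewrite conjcK. Qed.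

Lemma conjs_emb a : conjs R k (emb a) = emb a.
Proof. by case: k => //=; rewrite /conjc oppr0. Qed.

Lemma conjs0 : conjs R k 0 = 0.
Proof. by rewrite -emb0 conjs_emb. Qed.

Lemma conjs_eq0 (z : K) : (conjs R k z == 0) = (z == 0).
Proof. by rewrite -{1}conjs0 (inj_eq (can_inj conjsK)). Qed.

Lemma res0 : res (0 : K) = 0.
Proof. by rewrite -emb0 embK. Qed.

Lemma res_conjs (z : K) : res (conjs R k z) = res z.
Proof. by move: z; case: k => //= -[a b]. Qed.

Lemma absE (z : K) : `|z| = emb (absR z).
Proof. exact: emb_ge0P. Qed.

Lemma absR_ge0 (z : K) : 0 <= absR z.
Proof. by rewrite -(emb_le 0) emb0 -absE. Qed.

Lemma mul_conjs (z : K) : z * conjs R k z = emb (absR z ^+ 2).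
Proof.
rewrite embX -absE; move: z; case: k => /= z; last by rewrite sqr_normc.
by rewrite real_normK ?num_real// expr2.
Qed.

Lemma absRM (y z : K) : absR (y * z) = absR y * absR z.
Proof.
by apply: (can_inj embK); rewrite embM -!absE normrM.
Qed.

Lemma absR_conjs (z : K) : absR (conjs R k z) = absR z.
Proof.
apply: (can_inj embK); rewrite -!absE.
by move: z; case: k => //= z; rewrite normcJ.
Qed.

Lemma absR_emb a : absR (emb a : K) = `|a|.
Proof.
apply: (can_inj embK); rewrite -absE.
by case: k => //=; rewrite normc_def /= expr0n addr0 sqrtr_sqr.
Qed.

Lemma absR0 : absR (0 : K) = 0.
Proof. by rewrite -emb0 absR_emb normr0. Qed.

Lemma absR_eq0 (z : K) : absR z = 0 -> z = 0.
Proof. by move=> h; apply/eqP; rewrite -normr_eq0 absE h emb0. Qed.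

Lemma ler_res (z : K) : res z <= absR z.
Proof.
rewrite -(emb_le _) -absE; move: z; case: k => /= z; first exact: ler_norm.
by apply: le_trans (normc_ge_Re z); rewrite lecR ler_norm.
Qed.

End ScalarTheory.

(** * Norms, inner products and convergence in real terms *)

Section Hilbert.
Variables (R : realType) (k : scalar_kind).
Local Notation K := (scalars R k).

Section Norm.
Variable V : normedModType K.
Implicit Types x y : V.

Lemma normE x : `|x| = emb (normR x).
Proof. exact: emb_ge0P. Qed.

Lemma normR_ge0 x : 0 <= normR x.
Proof. by rewrite -(@emb_le _ k) emb0 -normE. Qed.

Lemma normR0 : normR (0 : V) = 0.
Proof. by apply: (can_inj (@embK R k)); rewrite -normE normr0 emb0. Qed.

Lemma normR_eq0 x : normR x = 0 -> x = 0.
Proof. by move=> h; apply/eqP; rewrite -normr_eq0 normE h emb0. Qed.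

Lemma normRZ a x : normR (a *: x) = absR a * normR x.
Proof. by apply: (can_inj (@embK R k)); rewrite embM -!normE normrZ absE. Qed.

Lemma normRN x : normR (- x) = normR x.
Proof. by rewrite /normR normrN. Qed.

Lemma normRB x y : normR (x - y) = normR (y - x).
Proof. by rewrite /normR distrC. Qed.

Lemma normRD x y : normR (x + y) <= normR x + normR y.
Proof. by rewrite -(@emb_le _ k) embD -!normE ler_normD. Qed.

Lemma normR_sum I (r : seq I) (P : pred I) (F : I -> V) :
  normR (\sum_(i <- r | P i) F i) <= \sum_(i <- r | P i) normR (F i).
Proof.
elim/big_ind2: _ => [|x a y b ha hb|//]; first by rewrite normR0.
by apply: le_trans (normRD _ _) _; apply: lerD.
Qed.

(** Convergence and completeness with [epsilon] in [R] rather than in [K]. *)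
Lemma cvgR (u : nat -> V) (l : V) : u @ \oo --> l <->
  forall e : R, 0 < e -> exists N, forall n, (N <= n)%N -> normR (l - u n) < e.
Proof.
split=> [/cvgrPdist_lt h e e0|h].
  have /h[N _ hN] : 0 < emb e :> K by rewrite -(emb0 R k) emb_lt.
  by exists N => n Nn; have := hN n Nn; rewrite /= normE emb_lt.
apply/cvgrPdist_lt => e e0; rewrite (emb_ge0P (ltW e0)).
have [|N hN] := h (res e); first by rewrite -(@emb_lt _ k) emb0 -emb_ge0P// ltW.
by exists N => // n Nn; rewrite /= normE emb_lt hN.
Qed.

Lemma cvg_normR_le (u : nat -> V) (l : V) C : u @ \oo --> l ->
  (exists N, forall n, (N <= n)%N -> normR (u n) <= C) -> normR l <= C.
Proof.
move=> /cvgR ul [N hN]; apply/ler_addgt0Pr => e e0.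
have [M hM] := ul e e0.
have -> : l = u (maxn N M) + (l - u (maxn N M)) by rewrite addrC subrK.
apply: le_trans (normRD _ _) _; apply: lerD; first exact/hN/leq_maxl.
exact/ltW/hM/leq_maxr.
Qed.

Lemma cvg_normR_ge (u : nat -> V) (l : V) C : u @ \oo --> l ->
  (exists N, forall n, (N <= n)%N -> C <= normR (u n)) -> C <= normR l.
Proof.
move=> /cvgR ul [N hN]; apply/ler_addgt0Pr => e e0.
have [M hM] := ul e e0.
apply: le_trans (hN _ (leq_maxl N M)) _.
have -> : u (maxn N M) = l - (l - u (maxn N M)) by rewrite subKr.
apply: le_trans (normRD _ _) _; rewrite normRN lerD2l.
exact/ltW/hM/leq_maxr.
Qed.

Lemma seq_cvg_unique (u : nat -> V) (l l' : V) :
  u @ \oo --> l -> u @ \oo --> l' -> l = l'.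
Proof.
move=> h h'; exact: (@cvg_unique _ (@norm_hausdorff _ V) _ _ _ _ h h').
Qed.

End Norm.

Lemma cauchyR (V : completeNormedModType K) (u : nat -> V) :
  (forall e : R, 0 < e -> exists N, forall m n, (N <= m)%N -> (m <= n)%N ->
     normR (u n - u m) < e) -> exists l : V, u @ \oo --> l.
Proof.
move=> h; suff : cvgn u by exists (limn u).
apply/cauchy_cvgP/cauchyP => e e0.
have [|N hN] := h (res e); first by rewrite -(@emb_lt _ k) emb0 -emb_ge0P// ltW.
exists (u N), N => // n Nn.
rewrite -ball_normE /ball_ /= normE (emb_ge0P (ltW e0)).
by rewrite emb_lt normRB hN.
Qed.

Lemma geometric_cvg (V : completeNormedModType K) (u : nat -> V) :
  (forall j, normR (u j) <= 2^-1 ^+ j) -> exists l : V, series u @ \oo --> l.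
Proof.
move=> hu; apply: cauchyR => e e0.
have geo m n : (m <= n)%N ->
    normR (series u n - series u m) <= 2 * 2^-1 ^+ m - 2 * 2^-1 ^+ n.
  elim: n => [|n IH]; first by rewrite leqn0 => /eqP ->; rewrite !subrr normR0.
  rewrite leq_eqVlt => /orP[/eqP ->|mn]; first by rewrite !subrr normR0.
  rewrite /series /= big_nat_recr//= addrAC; apply: le_trans (normRD _ _) _.
  apply: le_trans (lerD (IH mn) (hu n)) _; rewrite exprS.
  by move: (2^-1 ^+ n : R) (2^-1 ^+ m : R) => p q; lra.
have : (fun n => 2^-1 ^+ n : R) @ \oo --> (0 : R).
  by apply: cvg_expr; rewrite ger0_norm; lra.
move=> /cvgrPdist_lt /(_ (e / 2)) []; first lra.
move=> N _ hN; exists N => m n Nm mn.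
apply: le_lt_trans (geo _ _ mn) _.
have := hN m Nm; rewrite /= sub0r normrN ger0_norm ?exprn_ge0 ?invr_ge0// => h.
have : 0 <= (2^-1 ^+ n : R) by rewrite exprn_ge0 ?invr_ge0.
by lra.
Qed.

Lemma bounded_cvg (V : normedModType K) (B : {linear V -> V}) M (u : nat ->
  V) (l : V) :
  (forall x, normR (B x) <= M * normR x) -> u @ \oo --> l ->
  (B \o u) @ \oo --> B l.
Proof.
move=> hB /cvgR ul; apply/cvgR => e e0.
have M0 : 0 < `|M| + 1 by rewrite ltr_pwDr.
have [|N hN] := ul (e / (`|M| + 1)); first exact: divr_gt0.
exists N => n Nn; have := hN n Nn; rewrite ltr_pdivlMr// => h.
rewrite /= -linearB; apply: le_lt_trans (hB _) _; apply: le_lt_trans h.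
rewrite mulrC; apply: ler_wpM2l; first exact: normR_ge0.
by apply: le_trans (ler_norm _) _; rewrite lerDl.
Qed.

Section Inner.
Variable H : completeNormedModType K.
Variable ip : {dot H for conjs R k}.
Hypothesis Hip : ip_induces_norm ip.
Implicit Types x y z : H.

Lemma ipDl z : {morph ip^~ z : x y / x + y}.
Proof. exact: linearDl. Qed.

Lemma ipBl z : {morph ip^~ z : x y / x - y}.
Proof. exact: linearBl. Qed.

Lemma ipZl a x z : ip (a *: x) z = a * ip x z.
Proof. exact: linearZl_LR. Qed.

Lemma ip0l z : ip 0 z = 0.
Proof. exact: linear0l. Qed.

Lemma ip_suml z I (r : seq I) (P : pred I) (F : I -> H) :
  ip (\sum_(i <- r | P i) F i) z = \sum_(i <- r | P i) ip (F i) z.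
Proof. exact: linear_sumlz. Qed.

Lemma ipC x y : ip x y = conjs R k (ip y x).
Proof.
have := @hermitian_subproof _ _ false (conjs R k) ip x y.
by rewrite expr0 mul1r.
Qed.

Lemma ipDr z : {morph ip z : x y / x + y}.
Proof. exact: linearDr. Qed.

Lemma ipZr a x z : ip z (a *: x) = conjs R k a * ip z x.
Proof. by rewrite ipC ipZl conjsM -ipC. Qed.

Lemma ip0r z : ip z 0 = 0.
Proof. exact: linear0r. Qed.

Lemma ip_sumr z I (r : seq I) (P : pred I) (F : I -> H) :
  ip z (\sum_(i <- r | P i) F i) = \sum_(i <- r | P i) ip z (F i).
Proof. exact: linear_sumr. Qed.

Lemma ipxx x : ip x x = emb (normR x ^+ 2).
Proof. by rewrite Hip normE embX. Qed.

Lemma absR_ipC x y : absR (ip x y) = absR (ip y x).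
Proof. by rewrite ipC absR_conjs. Qed.

Lemma normRD_sqr x y :
  normR (x + y) ^+ 2 = normR x ^+ 2 + normR y ^+ 2 + 2 * res (ip x y).
Proof.
rewrite -[LHS](@embK R k) -ipxx ipDl !ipDr !resD !ipxx !embK (ipC y x)
  res_conjs.
by ring.
Qed.

Lemma parallelogram x y :
  normR (x + y) ^+ 2 + normR (x - y) ^+ 2 = 2 * normR x ^+ 2 + 2 * normR y ^+ 2.
Proof.
rewrite !normRD_sqr normRN; have -> : ip x (- y) = - ip x y by exact: linearNr.
by rewrite resN; ring.
Qed.

(** Expand [0 <= | |y|^2 x - <x,y> y |^2]. *)
Lemma Cauchy_Schwarz x y : absR (ip x y) <= normR x * normR y.
Proof.
have [y0|y0] := eqVneq (normR y) 0.
  by rewrite (normR_eq0 y0) ip0r absR0 normR0 mulr0.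
have yp : 0 < normR y by rewrite lt_neqAle eq_sym y0 normR_ge0.
rewrite -(@ler_pXn2r _ 2%N)// ?nnegrE ?absR_ge0 ?mulr_ge0 ?normR_ge0//.
have : 0 <= normR (emb (normR y ^+ 2) *: x - ip x y *: y) ^+ 2
  by rewrite sqr_ge0.
rewrite normRD_sqr normRN !normRZ absR_emb -scaleNr ipZl ipZr.
have -> : conjs R k (- ip x y) = - conjs R k (ip x y).
  by apply/eqP; rewrite -addr_eq0 -conjsD addNr -(emb0 R k) conjs_emb.
rewrite mulNr mulrN resN res_emb_mul [conjs _ _ _ * _]mulrC mul_conjs embK.
rewrite ger0_norm ?sqr_ge0//; set a := absR _; set nx := normR x;
  set ny := normR y.
have -> : (ny ^+ 2 * nx) ^+ 2 + (a * ny) ^+ 2 + 2 * - (ny ^+ 2 * a ^+ 2) =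
  ny ^+ 2 * ((nx * ny) ^+ 2 - a ^+ 2) by ring.
by rewrite pmulr_rge0 ?exprn_gt0// subr_ge0.
Qed.

Lemma cvg_ip_const (u : nat -> H) (l : H) y c : u @ \oo --> l ->
  (exists N, forall n, (N <= n)%N -> ip (u n) y = c) -> ip l y = c.
Proof.
move=> /cvgR ul [N hN]; apply/eqP; rewrite -subr_eq0; apply/eqP/absR_eq0/eqP.
rewrite eq_le absR_ge0 andbT; apply/ler_addgt0Pr => e e0; rewrite add0r.
have n0 : 0 < normR y + 1 by rewrite ltr_pwDr ?normR_ge0.
have [|M hM] := ul (e / (normR y + 1)); first exact: divr_gt0.
rewrite -(hN (maxn N M)) ?leq_maxl// -ipBl.
apply: le_trans (Cauchy_Schwarz _ _) _.
have := hM _ (leq_maxr N M); rewrite ltr_pdivlMr// => /ltW.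
by apply: le_trans; apply: ler_wpM2l; rewrite ?normR_ge0// lerDl.
Qed.

Lemma cvg_res_ip_le (u : nat -> H) (l : H) y a : u @ \oo --> l ->
  (exists N, forall n, (N <= n)%N -> res (ip (u n) y) <= a) -> res (ip l y) <=
    a.
Proof.
move=> /cvgR ul [N hN]; apply/ler_addgt0Pr => e e0.
have n0 : 0 < normR y + 1 by rewrite ltr_pwDr ?normR_ge0.
have [|M hM] := ul (e / (normR y + 1)); first exact: divr_gt0.
have -> : l = u (maxn N M) + (l - u (maxn N M)) by rewrite addrC subrK.
rewrite ipDl resD; apply: lerD; first exact/hN/leq_maxl.
apply: le_trans (ler_res _) _; apply: le_trans (Cauchy_Schwarz _ _) _.
have := hM _ (leq_maxr N M); rewrite ltr_pdivlMr// => /ltW.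
by apply: le_trans; apply: ler_wpM2l; rewrite ?normR_ge0// lerDl.
Qed.

End Inner.
End Hilbert.

(** * Rearranging the natural numbers block by block *)

Section Blocks.
Local Open Scope nat_scope.
Variable N_ : nat -> nat.
Hypotheses (N_0 : N_ 0 = 0) (N_S : forall j, N_ j < N_ j.+1).

Lemma block_mono : {homo N_ : i j / i <= j}.
Proof. by apply: homo_leq => // [i j l|j]; [exact: leq_trans|exact: ltnW]. Qed.

Lemma block_ge j : j <= N_ j.
Proof. by elim: j => // j IH; apply: leq_ltn_trans IH (N_S j). Qed.

Lemma block_ex i : exists j, N_ j <= i < N_ j.+1.
Proof.
elim: i => [|i [j /andP[ji ij]]]; first by exists 0; have := N_S 0; rewrite N_0.
have [h|h] := ltnP i.+1 (N_ j.+1); first by exists j; rewrite h andbT ltnW.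
by exists j.+1; rewrite h (leq_ltn_trans ij)// N_S.
Qed.

Lemma block_uniq i j j' : N_ j <= i < N_ j.+1 ->
  N_ j' <= i < N_ j'.+1 -> j = j'.
Proof.
have W l l' : l < l' -> N_ l <= i < N_ l.+1 -> ~~ (N_ l' <= i < N_ l'.+1).
  move=> ll /andP[_ h]; rewrite negb_and -ltnNge; apply/orP; left.
  exact: leq_trans h (block_mono ll).
move=> hj hj'; case: (ltngtP j j') => // h.
  by move: (W _ _ h hj); rewrite hj'.
by move: (W _ _ h hj'); rewrite hj.
Qed.

(** Within each block the indices satisfying [a] are listed first. The masked
    sum over a block is then a difference of two partial sums of the rearranged
    series, so convergence of the rearrangement forces it to be small. *)
Lemma block_rearrangement (a : pred nat) : exists2 s : nat -> nat, bijective s &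
  forall (j : nat), exists m, forall (V : nmodType) (v : nat -> V),
    (\sum_(N_ j <= i < N_ j + m) v (s i) =
     \sum_(N_ j <= i < N_ j.+1 | a i) v i)%R.
Proof.
have [blk blkP] := choice block_ex.
have blkE i j : N_ j <= i < N_ j.+1 -> blk i = j by exact: block_uniq.
pose I j := index_iota (N_ j) (N_ j.+1).
pose L j := seq.filter a (I j) ++ seq.filter (predC a) (I j).
have LI j : perm_eq (L j) (I j) by rewrite perm_filterC.
have memL j i : (i \in L j) = (N_ j <= i < N_ j.+1).
  by rewrite (perm_mem (LI j)) mem_index_iota.
have sizeL j : size (L j) =
  N_ j.+1 - N_ j by rewrite (perm_size (LI j)) size_iota.
have uniqL j : uniq (L j) by rewrite (perm_uniq (LI j)) iota_uniq.
pose s i := nth 0 (L (blk i)) (i - N_ (blk i)).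
(* The inverse permutation: the rank of [i] in the list of its block. *)
pose t i := N_ (blk i) + index i (L (blk i)).
have sizeblk i : i - N_ (blk i) < size (L (blk i)).
  by rewrite sizeL; have /andP[] := blkP i; lia.
have blks i : blk (s i) = blk i by apply: blkE; rewrite -memL mem_nth.
have idx i : index i (L (blk i)) < N_ (blk i).+1 - N_ (blk i).
  by rewrite -sizeL index_mem memL.
have blkt i : blk (t i) = blk i.
  by apply: blkE; rewrite /t; have := idx i; have := N_S (blk i); lia.
exists s; first exists t.
- by move=> i; rewrite /t blks /s index_uniq// subnKC//; case/andP: (blkP i).
- by move=> i; rewrite /s blkt /t addKn nth_index// memL.
move=> j; exists (size (seq.filter a (I j))) => V v.
rewrite -(big_map s xpredT v) -[RHS]big_filter; congr (\big[_/_]_(_ <- _) _).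
rewrite -[RHS]/(seq.filter a (I j)) /index_iota addKn.
have sa : size (seq.filter a (I j)) <= N_ j.+1 - N_ j.
  by rewrite -sizeL size_cat leq_addr.
apply: (@eq_from_nth _ 0); first by rewrite size_map size_iota.
move=> i; rewrite size_map size_iota => ilt.
rewrite (nth_map 0) ?size_iota// nth_iota// /s (_ : blk _ = j).
  by rewrite addKn nth_cat ilt.
by apply: blkE; lia.
Qed.

End Blocks.

(** * Unconditional bases: the gliding hump *)

Lemma sum_nat_diff (V : zmodType) (F : nat -> V) m n : (m <= n)%N ->
  \sum_(m <= i < n) F i = \sum_(0 <= i < n) F i - \sum_(0 <= i < m) F i.
Proof.
move=> mn; rewrite [X in _ = X - _](@big_cat_nat _ _ _ m 0%N n)//=.
by rewrite addrAC subrr add0r.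
Qed.

Section UnconditionalBasis.
Variables (R : realType) (k : scalar_kind).
Local Notation K := (scalars R k).
Variable H : completeNormedModType K.
Variable ip : {dot H for conjs R k}.
Hypothesis Hip : ip_induces_norm ip.

(** A bounded sum of nonnegative terms [b i] is Cauchy, and so is [series u] as
    soon as its blocks are controlled by those of [b]. *)
Lemma cvg_dominated (u : nat -> H) (b : nat -> R) (C : R) :
  (forall m n, (m <= n)%N ->
     normR (\sum_(m <= i < n) u i) ^+ 2 <= \sum_(m <= i < n) b i) ->
  (forall n, \sum_(0 <= i < n) b i <= C) ->
  exists l : H, series u @ \oo --> l.
Proof.
move=> hub hC.
pose S n := \sum_(0 <= i < n) b i.
have Smono m n : (m <= n)%N -> S m <= S n.
  by move=> mn; rewrite -subr_ge0 -sum_nat_diff//;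
    apply: le_trans (hub _ _ mn); rewrite sqr_ge0.
have hs : has_sup (range S).
  by split; [exists (S 0%N), 0%N|exists C => _ [n _ <-]; exact: hC].
apply: cauchyR => e e0.
have e2 : 0 < e ^+ 2 by rewrite exprn_gt0.
have [_ [N _ <-] hN] := sup_adherent e2 hs.
exists N => m n Nm mn.
rewrite -(@ltr_pXn2r _ 2%N)// ?nnegrE ?normR_ge0 ?ltW//.
rewrite /series /= -sum_nat_diff//.
apply: le_lt_trans (hub _ _ mn) _; rewrite sum_nat_diff//.
have := ub_le_sup hs.2 (ex_intro2 _ _ n I erefl); have := Smono _ _ Nm.
by move: hN; rewrite -/(S n) -/(S m); lra.
Qed.

Variables f g : nat -> H.
Hypothesis fg : biorthogonal ip f g.

Lemma coef_basis_sum c m n j :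
  ip (\sum_(m <= i < n) c i *: f i) (g j) = if (m <= j < n)%N then c j else 0.
Proof.
rewrite ip_suml; under eq_bigr do rewrite ipZl fg mulr_natr mulrb.
by rewrite -big_mkcond/= big_nat1_eq.
Qed.

Hypothesis fcvg :
  forall x, unconditionally_cvg_to (fun n => ip x (g n) *: f n) x.

Lemma coef_eq0 x : (forall n, ip x (g n) = 0) -> x = 0.
Proof.
move=> h; have [hx _] := fcvg x; apply: (seq_cvg_unique hx).
apply/cvgR => e e0; exists 0%N => n _.
by rewrite /series /= big1 ?subr0 ?normR0// => i _; rewrite h scale0r.
Qed.

(** Gliding hump. If masking could turn, beyond any index, a combination of
    norm at most [2^-j] into one of norm 1, the combinations taken over
    successive blocks would add up to a vector [x] by geometric convergence;
    biorthogonality makes their coefficients those of [x]. The permutation that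
    lists the masked indices of each block first then rearranges the expansion
    of [x] into a divergent series. *)
Lemma masks_bounded_by_gluing (F : nat -> nat -> nat * pred nat * (nat -> K)) :
  (forall m j, let: (n, a, c) := F m j in [/\ (m < n)%N,
     normR (\sum_(m <= i < n) c i *: f i) <= 2^-1 ^+ j &
     normR (\sum_(m <= i < n | a i) c i *: f i) = 1]) -> False.
Proof.
move=> hF.
pose N_ := fix N_ j := if j is j'.+1 then (F (N_ j') j').1.1 else 0%N.
have N_S j : (N_ j < N_ j.+1)%N.
  by rewrite /=; have := hF (N_ j) j; case: (F _ _) => -[n a] c [].
have N_0 : N_ 0%N = 0%N by [].
have [blk blkP] := choice (block_ex N_0 N_S).
have blkE i j : (N_ j <= i < N_ j.+1)%N -> blk i = j.
  by move=> h; apply: block_uniq h => //; exact: blkP.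
pose a i := (F (N_ (blk i)) (blk i)).1.2 i.
pose d i := (F (N_ (blk i)) (blk i)).2 i.
pose U j := \sum_(N_ j <= i < N_ j.+1) d i *: f i.
have hd j : normR (U j) <= 2^-1 ^+ j.
  have := hF (N_ j) j; case E: (F _ _) => [[n b] c] [h1 h2 h3].
  rewrite /U (_ : N_ j.+1 = n); last by rewrite /= E.
  apply: le_trans h2; rewrite le_eqVlt; apply/orP; left; apply/eqP; congr normR.
  apply: eq_big_nat => i hi; congr (_ *: _).
  by rewrite /d (blkE i j) ?E//= E.
have ha j : normR (\sum_(N_ j <= i < N_ j.+1 | a i) d i *: f i) = 1.
  have := hF (N_ j) j; case E: (F _ _) => [[n b] c] [h1 h2 h3].
  rewrite (_ : N_ j.+1 = n); last by rewrite /= E.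
  rewrite -h3; congr normR.
  rewrite big_nat_cond [RHS]big_nat_cond; apply: eq_big => [i|i /andP[hi _]].
    have [hi|//] := boolP (N_ j <= i < n)%N.
    by rewrite /a (blkE i j) ?E//= E.
  by rewrite /d (blkE i j) ?E//= E.
have UE m n : (m <= n)%N ->
    \sum_(m <= j < n) U j = \sum_(N_ m <= i < N_ n) d i *: f i.
  elim: n => [|n IH]; first by rewrite leqn0 => /eqP ->; rewrite !big_geq.
  rewrite leq_eqVlt => /orP[/eqP ->|mn]; first by rewrite !big_geq.
  rewrite big_nat_recr//= IH// [RHS](@big_cat_nat _ _ _ (N_ n))//=.
    exact: (block_mono N_S).
  exact/ltnW/N_S.
have [x] := geometric_cvg hd.
have -> : series U = fun n => \sum_(0 <= i < N_ n) d i *: f i.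
  by apply/funext => n; rewrite /series /= UE.
move=> hx.
have xd j : ip x (g j) = d j.
  apply: (cvg_ip_const Hip hx); exists j.+1 => n jn; rewrite coef_basis_sum /=.
  by rewrite (leq_trans jn (block_ge N_S n)).
have [s sbij hs] := block_rearrangement N_0 N_S a.
have [_ /(_ s sbij) /cvg_ex[l /cvgR /(_ (2^-1))[|N hN]]] := fcvg x; first lra.
have [m hm] := hs N.
have h1 := hN _ (block_ge N_S N).
have h2 := hN (N_ N + m)%N (leq_trans (block_ge N_S N) (leq_addr _ _)).
have := ha N; rewrite -hm => E.
have : normR (\sum_(N_ N <= i < N_ N + m) (d (s i) *: f (s i))) < 1.
  set S := series _ in h1 h2.
  have -> : \sum_(N_ N <= i < N_ N + m) d (s i) *: f (s i) =
      (l - S (N_ N)) + - (l - S (N_ N + m)%N).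
    rewrite opprB addrC addrA subrK sum_nat_diff ?leq_addr//.
    by rewrite /S /series /=; under [X in _ = X - _]eq_bigr do rewrite xd;
       under [X in _ = _ - X]eq_bigr do rewrite xd.
  apply: le_lt_trans (normRD _ _) _; rewrite normRN; lra.
by rewrite E ltxx.
Qed.
End UnconditionalBasis.

(** * Unconditional bases: the Koethe-Toeplitz theorem *)

Section KotheToeplitz.
Variables (R : realType) (k : scalar_kind).
Local Notation K := (scalars R k).
Variable H : completeNormedModType K.
Variable ip : {dot H for conjs R k}.
Hypothesis Hip : ip_induces_norm ip.

(** By the parallelogram identity [|x + y|^2] and [|x - y|^2] average to
    [|x|^2 + |y|^2]: one of them is at most this value, the other at least. *)
Lemma exists_sign (x y : H) : exists s t : bool,
  normR (x + (-1) ^+ s *: y) ^+ 2 <= normR x ^+ 2 + normR y ^+ 2 /\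
  normR x ^+ 2 + normR y ^+ 2 <= normR (x + (-1) ^+ t *: y) ^+ 2.
Proof.
have := parallelogram Hip x y.
move=> h; set S := normR x ^+ 2 + normR y ^+ 2.
have [h1|/ltW h1] := leP (normR (x + y) ^+ 2) S.
  exists false, true; rewrite expr0 scale1r expr1 scaleN1r; split=> //.
  by move: h h1; rewrite /S; do 4!move: (_ ^+ 2 : R) => ?; lra.
exists true, false; rewrite expr0 scale1r expr1 scaleN1r; split=> //.
by move: h h1; rewrite /S; do 4!move: (_ ^+ 2 : R) => ?; lra.
Qed.

(** Signs chosen one after the other replace the average over all signs in the
    identity [avg |sum +-v_i|^2 = sum |v_i|^2]. *)
Lemma exists_signs (v : nat -> H) m n : exists a b : nat -> bool,
  normR (\sum_(m <= i < n) (-1) ^+ a i *: v i) ^+ 2 <=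
    \sum_(m <= i < n) normR (v i) ^+ 2 /\
  \sum_(m <= i < n) normR (v i) ^+ 2 <=
    normR (\sum_(m <= i < n) (-1) ^+ b i *: v i) ^+ 2.
Proof.
elim: n => [|n [a [b [ha hb]]]].
  by exists (fun=> false), (fun=> false); rewrite !big_geq// normR0 expr0n.
have [nm|mn] := ltnP n m.
  by exists (fun=> false), (fun=> false); rewrite !big_geq// normR0 expr0n.
have step (s : nat -> bool) (t : bool) :
    \sum_(m <= i < n.+1) (-1) ^+ (if i == n then t else s i) *: v i =
    \sum_(m <= i < n) (-1) ^+ s i *: v i + (-1) ^+ t *: v n.
  rewrite big_nat_recr//= eqxx; congr (_ + _).
  by apply: eq_big_nat => i /andP[_ h]; rewrite ltn_eqF.
have [ta [_ [hta _]]] :=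
  exists_sign (\sum_(m <= i < n) (-1) ^+ a i *: v i) (v n).
have [_ [tb [_ htb]]] :=
  exists_sign (\sum_(m <= i < n) (-1) ^+ b i *: v i) (v n).
exists (fun i => if i == n then ta else a i),
  (fun i => if i == n then tb else b i).
rewrite !step big_nat_recr//=; split.
  by apply: le_trans hta _; rewrite lerD2r.
by apply: le_trans htb; rewrite lerD2r.
Qed.

Variables f g : nat -> H.
Hypothesis fg : biorthogonal ip f g.
Hypothesis fcvg :
  forall x, unconditionally_cvg_to (fun n => ip x (g n) *: f n) x.

(** Otherwise masking is unbounded beyond every index, and rescaling to a masked
    sum of norm 1 gives the humps that [masks_bounded_by_gluing] forbids. *)
Lemma mask_tail_bound : exists m (C : R), 0 <= C /\ forall n a (c : nat -> K),
  normR (\sum_(m <= i < n | a i) c i *: f i) <=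
    C * normR (\sum_(m <= i < n) c i *: f i).
Proof.
apply: contrapT => /forallNP hno.
have bad m j : exists F : nat * pred nat * (nat -> K), let: (n, a, c) := F in
   [/\ (m < n)%N,
     normR (\sum_(m <= i < n) c i *: f i) <= 2^-1 ^+ j &
     normR (\sum_(m <= i < n | a i) c i *: f i) = 1].
  have /forallNP/(_ (2 ^+ j))/not_andP[|] := hno m; first by rewrite exprn_ge0.
  move=> /existsNP[n] /existsNP[a] /existsNP[c] /negP; rewrite -ltNge => h.
  set t := (X in _ < X) in h.
  have t0 : 0 < t by apply: le_lt_trans h;
    rewrite mulr_ge0 ?exprn_ge0 ?normR_ge0.
  exists (n, a, fun i => emb t^-1 * c i).
  have tE P : \sum_(m <= i < n | P i) (emb t^-1 * c i) *: f i =
      emb t^-1 *: \sum_(m <= i < n | P i) c i *: f i.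
    by rewrite scaler_sumr; apply: eq_bigr => i _; rewrite scalerA.
  rewrite !tE !normRZ absR_emb ger0_norm ?invr_ge0 ?(ltW t0)//; split.
  - rewrite ltnNge; apply/negP => mn; move: t0.
    by rewrite /t big_geq// normR0 ltxx.
  - by rewrite exprVn ler_pdivrMl// ler_pdivlMr ?exprn_gt0// mulrC ltW.
  - by rewrite -/t mulVf// gt_eqF.
have [F hF] := choice (fun mj : nat * nat => bad mj.1 mj.2).
apply: (masks_bounded_by_gluing Hip fg fcvg (F := fun m j => F (m, j))
  (fun m j => hF (m, j))).
Qed.

(** The first [N] terms of a combination [u] cost at most
    [sum_(i < N) |g_i| |f_i| |u|], since their coefficients are the [<u,g_i>];
    the tail is [mask_tail_bound]. *)
Lemma mask_bound : exists2 C : R, 0 <= C & forall m n a (c : nat -> K),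
  normR (\sum_(m <= i < n | a i) c i *: f i) <=
    C * normR (\sum_(m <= i < n) c i *: f i).
Proof.
have [N [C [C0 hC]]] := mask_tail_bound.
pose D := \sum_(0 <= i < N) normR (g i) * normR (f i).
have D0 : 0 <= D by rewrite sumr_ge0// => i _; rewrite mulr_ge0 ?normR_ge0.
exists (D + C * (1 + D)) => [|m n a c].
  by rewrite addr_ge0 ?mulr_ge0 ?addr_ge0.
pose c' i := if (m <= i < n)%N then c i else 0.
have c'E P : \sum_(m <= i < n | P i) c i *: f i =
    \sum_(0 <= i < N + n | P i) c' i *: f i.
  rewrite (big_nat_widenl _ 0%N)// (big_nat_widen _ _ (N + n)%N) ?leq_addl//.
  rewrite big_mkcond [RHS]big_mkcond; apply: eq_bigr => i _.
  rewrite /c'; case: (P i) => //=; case: (m <= i)%N; case: (i < n)%N;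
    rewrite ?scale0r//.
rewrite !c'E; move: c' {c'E} => c'; set M := (N + n)%N.
have NM : (N <= M)%N by rewrite leq_addr.
set u := \sum_(0 <= i < M) c' i *: f i.
have head P : normR (\sum_(0 <= i < N | P i) c' i *: f i) <= D * normR u.
  apply: le_trans (normR_sum _ _ _) _; rewrite mulr_suml.
  rewrite big_mkcond /=; apply: ler_sum_nat => i /andP[_ iN].
  have h : 0 <= normR (g i) * normR (f i) * normR u
    by rewrite !mulr_ge0 ?normR_ge0.
  case: (P i) => //; rewrite normRZ mulrAC ler_wpM2r ?normR_ge0// mulrC.
  have := Cauchy_Schwarz Hip u (g i); rewrite (coef_basis_sum fg)/=.
  by rewrite (leq_trans iN NM).
rewrite (@big_cat_nat _ _ _ N)//=; apply: le_trans (normRD _ _) _.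
rewrite mulrDl; apply: lerD; first exact: head.
apply: le_trans (hC _ _ _) _; rewrite -mulrA ler_wpM2l// sum_nat_diff//.
apply: le_trans (normRD _ _) _; rewrite normRN mulrDl mul1r lerD2l.
exact: head.
Qed.

(** Changing the signs on a set subtracts the masked sum twice. *)
Lemma sign_bound : exists2 C : R, 0 < C &
  forall m n (s : nat -> bool) (v : nat -> H),
  (forall i, exists c : K, v i = c *: f i) ->
  normR (\sum_(m <= i < n) (-1) ^+ s i *: v i) ^+ 2 <=
    C * normR (\sum_(m <= i < n) v i) ^+ 2.
Proof.
have [C C0 hC] := mask_bound.
exists ((2 * C + 1) ^+ 2) => [|m n s v]; first by rewrite exprn_gt0//; lra.
move=> /choice[c hc]; rewrite -exprMn ler_pXn2r ?nnegrE ?normR_ge0//;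
  last first.
  by rewrite mulr_ge0 ?normR_ge0//; lra.
under [X in _ <= _ * normR X]eq_bigr do rewrite hc.
have -> : \sum_(m <= i < n) (-1) ^+ s i *: v i =
   \sum_(m <= i < n) c i *: f i +
     ((- 1) *: \sum_(m <= i < n | s i) c i *: f i +
      (- 1) *: \sum_(m <= i < n | s i) c i *: f i).
  rewrite scaler_sumr -big_split /= [X in _ = _ + X]big_mkcond -big_split /=.
  apply: eq_bigr => i _; rewrite hc; case: (s i).
    by rewrite expr1 !scaleN1r addrA subrr add0r.
  by rewrite expr0 scale1r addr0.
rewrite scaleN1r; apply: le_trans (normRD _ _) _.
rewrite mulrDl mul1r addrC lerD2r.
apply: le_trans (normRD _ _) _; rewrite normRN; have := hC m n s c; lra.
Qed.

(** The Koethe-Toeplitz theorem: a normalised unconditional basis is a Riesz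
    basis. A suitable choice of signs puts the sum of the squares below, or
    above, the squared norm of the signed sum, and sign changes only cost a
    constant factor by [sign_bound]. *)
Lemma Kothe_Toeplitz : exists2 C : R, 0 < C & forall m n (c : nat -> K),
  normR (\sum_(m <= i < n) c i *: f i) ^+ 2 <=
    C * \sum_(m <= i < n) absR (c i) ^+ 2 * normR (f i) ^+ 2 /\
  \sum_(m <= i < n) absR (c i) ^+ 2 * normR (f i) ^+ 2 <=
    C * normR (\sum_(m <= i < n) c i *: f i) ^+ 2.
Proof.
have [C C0 hC] := sign_bound; exists C => // m n c.
have -> : \sum_(m <= i < n) absR (c i) ^+ 2 * normR (f i) ^+ 2 =
    \sum_(m <= i < n) normR (c i *: f i) ^+ 2.
  by apply: eq_bigr => i _; rewrite normRZ exprMn.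
have [a [b [ha hb]]] := exists_signs (fun i => c i *: f i) m n.
split; last by apply: le_trans hb (hC _ _ _ _ _) => i; exists (c i).
have := hC m n a (fun i => (-1) ^+ a i *: (c i *: f i)).
under [X in normR X ^+ 2 <= _]eq_bigr do
  rewrite scalerA -expr2 sqrr_sign scale1r.
move=> h; apply: le_trans (h _) _.
  by move=> i; exists ((-1) ^+ a i * c i); rewrite scalerA.
by rewrite ler_pM2l.
Qed.

Lemma coef_sqsum_bound : exists2 C : R, 0 < C & forall x n,
  \sum_(0 <= i < n) absR (ip x (g i)) ^+ 2 * normR (f i) ^+ 2 <=
    C * normR x ^+ 2.
Proof.
have [C C0 hC] := Kothe_Toeplitz; exists C => // x n.
set S := \sum_(_ <= _ < _) _.
have S0 : 0 <= S by rewrite sumr_ge0// => i _; rewrite mulr_ge0 ?sqr_ge0.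
suff : Num.sqrt (S / C) <= normR x.
  rewrite -(@ler_pXn2r _ 2%N)// ?nnegrE ?sqrtr_ge0 ?normR_ge0//.
  by rewrite sqr_sqrtr ?divr_ge0 ?(ltW C0)// ler_pdivrMr// mulrC.
have [hx _] := fcvg x; apply: (cvg_normR_ge hx); exists n => m nm.
rewrite -(@ler_pXn2r _ 2%N)// ?nnegrE ?sqrtr_ge0 ?normR_ge0//.
rewrite sqr_sqrtr ?divr_ge0 ?(ltW C0)// ler_pdivrMr// mulrC.
apply: le_trans (hC 0%N m (fun i => ip x (g i))).2.
rewrite [leRHS](@big_cat_nat _ _ _ n)//= lerDl sumr_ge0// => i _.
by rewrite mulr_ge0 ?sqr_ge0.
Qed.

End KotheToeplitz.

(** * Orthonormal bases, and operators defined on a basis *)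

Section Orthonormal.
Variables (R : realType) (k : scalar_kind).
Local Notation K := (scalars R k).
Variable H : completeNormedModType K.
Variable ip : {dot H for conjs R k}.
Hypothesis Hip : ip_induces_norm ip.

Lemma normR_unit (x : H) : normR x = 1 -> ip x x = 1.
Proof. by move=> h; rewrite (ipxx Hip) h expr1n emb1. Qed.

(** [n] linear conditions on [n.+1] coefficients have a nonzero solution. It
    gives both the Gram-Schmidt vectors and the test vector against which a
    compact synthesis operator fails. *)
Lemma exists_unit_orthogonal (f g : nat -> H) (w : nat -> H) n :
  biorthogonal ip f g ->
  exists (c : nat -> K), normR (\sum_(0 <= i < n.+1) c i *: f i) = 1 /\
    forall j, (j < n)%N -> ip (\sum_(0 <= i < n.+1) c i *: f i) (w j) = 0.
Proof.
move=> fg; pose A : 'M[K]_(n.+1, n) := \matrix_(i, j) ip (f i) (w j).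
have /rowV0Pn[v /sub_kermxP vA v0] : kermx A != 0.
  by rewrite kermx_eq0 /row_free neq_ltn (leq_ltn_trans (rank_leq_col _)).
pose c i := v ord0 (inord i).
set u := \sum_(0 <= i < n.+1) c i *: f i.
have uw j : (j < n)%N -> ip u (w j) = 0.
  move=> jn; have := congr1 (fun M : 'rV_n => M ord0 (Ordinal jn)) vA.
  rewrite !mxE => <-; rewrite /u big_mkord ip_suml; apply: eq_bigr => i _.
  by rewrite ipZl mxE /c inord_val.
have u0 : 0 < normR u.
  rewrite lt_neqAle normR_ge0 andbT eq_sym;
    apply: contra v0 => /eqP/normR_eq0 u0.
  apply/eqP/rowP => i; rewrite mxE; have := coef_basis_sum fg c 0%N n.+1 i.
  by rewrite -/u u0 ip0l ltn_ord /= /c inord_val.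
exists (fun i => emb (normR u)^-1 * c i).
have -> : \sum_(0 <= i < n.+1) (emb (normR u)^-1 * c i) *: f i =
    emb (normR u)^-1 *: u.
  by rewrite scaler_sumr; apply: eq_bigr => i _; rewrite scalerA.
rewrite normRZ absR_emb ger0_norm ?invr_ge0 ?(ltW u0)// mulVf ?gt_eqF//;
  split => //.
by move=> j jn; rewrite ipZl uw// mulr0.
Qed.

Section OrthonormalSystem.
Variable e : nat -> H.
Hypothesis ee : biorthogonal ip e e.

Lemma normR_orthonormal_sum (c : nat -> K) m n :
  normR (\sum_(m <= i < n) c i *: e i) ^+ 2 = \sum_(m <= i < n) absR (c i) ^+ 2.
Proof.
apply: (can_inj (@embK R k)); rewrite -(ipxx Hip) {1}ip_suml.
rewrite (big_morph _ (@embD R k) (emb0 R k)).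
apply: eq_big_nat => i hi; rewrite ipZl ipC (coef_basis_sum ee) hi.
exact: mul_conjs.
Qed.

Lemma Bessel x n : \sum_(0 <= i < n) absR (ip x (e i)) ^+ 2 <= normR x ^+ 2.
Proof.
rewrite -normR_orthonormal_sum; set S := \sum_(_ <= _ < _) _.
have : ip (x - S) S = 0.
  rewrite {2}/S ip_sumr big_nat_cond big1// => i /andP[hi _].
  by rewrite ipZr ipBl /S (coef_basis_sum ee) hi subrr mulr0.
rewrite -{2}(subrK S x) (normRD_sqr Hip) => ->.
by rewrite res0 mulr0 addr0 lerDr sqr_ge0.
Qed.

Lemma complete_orthonormal_basis :
  (forall x, (forall n, ip x (e n) = 0) -> x = 0) -> orthonormal_basis ip e.
Proof.
move=> complete; split=> // x.
have [y hy] : exists y : H, series (fun n => ip x (e n) *: e n) @ \oo --> y.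
  apply: (cvg_dominated (b := fun i => absR (ip x (e i)) ^+ 2)
    (C := normR x ^+ 2)).
    by move=> m n _; rewrite normR_orthonormal_sum.
  exact: Bessel.
suff xy : y = x by rewrite xy in hy.
apply/esym/eqP; rewrite -subr_eq0; apply/eqP/complete => n.
rewrite ipBl; apply/eqP; rewrite subr_eq0; apply/eqP/esym.
apply: (cvg_ip_const Hip hy); exists n.+1 => m nm.
by rewrite /series /= (coef_basis_sum ee) nm.
Qed.

(** The nontrivial half of the Parseval identity, in the form that
    [coef_sqsum_ge] takes as input. *)
Lemma Parseval_le x C : orthonormal_basis ip e ->
  (forall n, \sum_(0 <= i < n) absR (ip x (e i)) ^+ 2 <= C) ->
  normR x ^+ 2 <= C.
Proof.
move=> [_ hx] hC.
have C0 : 0 <= C by have := hC 0%N; rewrite big_geq.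
rewrite -(sqr_sqrtr C0) ler_pXn2r ?nnegrE ?sqrtr_ge0 ?normR_ge0//.
apply: (cvg_normR_le (hx x)); exists 0%N => n _.
rewrite -(@ler_pXn2r _ 2%N)// ?nnegrE ?sqrtr_ge0 ?normR_ge0// sqr_sqrtr//.
by rewrite /series /= normR_orthonormal_sum.
Qed.

End OrthonormalSystem.

Section SqSum.
Implicit Types (h : nat -> H) (x : H).

Lemma coef_sqsum_le h x C : (coef_sqsum ip h x <= C%:E)%E <->
  forall n, \sum_(0 <= i < n) absR (ip x (h i)) ^+ 2 <= C.
Proof.
split=> [hC n|hC].
  rewrite -lee_fin -sumEFin; apply: le_trans hC.
  by apply: nneseries_lim_ge => i _ _; rewrite lee_fin sqr_ge0.
apply: lime_le; first by apply: is_cvg_nneseries => i _ _;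
  rewrite lee_fin sqr_ge0.
by apply: nearW => n; rewrite sumEFin lee_fin hC.
Qed.

(** Quantifying over the real upper bounds of the partial sums spares the case
    of an infinite sum to the applications. *)
Lemma coef_sqsum_ge h x a :
  (forall C, (forall n, \sum_(0 <= i < n) absR (ip x (h i)) ^+ 2 <= C) ->
    a <= C) ->
  (a%:E <= coef_sqsum ip h x)%E.
Proof.
move=> ha; have := @coef_sqsum_le h x.
have : (0 <= coef_sqsum ip h x)%E by apply: nneseries_ge0 => i _ _;
  rewrite lee_fin sqr_ge0.
case: (coef_sqsum ip h x) => [r _ hr|_ _|]; last by rewrite leNgt ltNy0.
  by rewrite lee_fin; apply: ha; apply/(hr r).
by rewrite leey.
Qed.
End SqSum.

Section Basis.
Variables f g : nat -> H.
Hypothesis fg : biorthogonal ip f g.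
Hypothesis fcvg :
  forall x, unconditionally_cvg_to (fun n => ip x (g n) *: f n) x.

Lemma orthogonal_to_basis y : (forall n, ip y (f n) = 0) -> y = 0.
Proof.
move=> hy; apply/normR_eq0/eqP; rewrite -sqrf_eq0; apply/eqP.
apply: (can_inj (@embK R k)); rewrite -(ipxx Hip) emb0.
have [hc _] := fcvg y; apply: (cvg_ip_const Hip hc); exists 0%N => n _.
by rewrite /series /= ip_suml big1// => i _;
  rewrite ipZl (ipC ip (f i)) hy conjs0 mulr0.
Qed.

(** Gram-Schmidt without recursion: [e n] is a unit vector in the span of
    [f 0, ..., f n] orthogonal to [f 0, ..., f n.-1]. Its leading coefficient
    cannot vanish, as [e n] would be orthogonal to itself; hence the [e n] have
    the same orthogonal complement as the [f n], which is zero. *)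
Lemma orthonormal_basis_ex : exists e : nat -> H, orthonormal_basis ip e.
Proof.
have [c hc] := choice (fun n => exists_unit_orthogonal f n fg).
pose e n := \sum_(0 <= i < n.+1) c n i *: f i.
have ef n j : (j < n)%N -> ip (e n) (f j) = 0 by case: (hc n) => _; apply.
have e1 n : normR (e n) = 1 by case: (hc n).
have elt n m : (m < n)%N -> ip (e n) (e m) = 0.
  move=> mn; rewrite {2}/e ip_sumr big_nat_cond big1// =>
    i /andP[/andP[_ im] _].
  by rewrite ipZr ef ?mulr0// (leq_trans im).
have cn n : c n n != 0.
  apply/eqP => cn0; have := normR_unit (e1 n);
    rewrite {2}/e big_nat_recr//= cn0 scale0r addr0.
  rewrite ip_sumr big_nat_cond big1 => [/eqP|i /andP[/andP[_ im] _]].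
    by rewrite eq_sym oner_eq0.
  by rewrite ipZr ef// mulr0.
exists e; apply: complete_orthonormal_basis.
  move=> n m; case: (ltngtP n m) => [h|h|->]; last by rewrite normR_unit.
    by rewrite ipC elt// conjs0.
  by rewrite elt.
move=> x hx; apply: orthogonal_to_basis; elim/ltn_ind => n IH.
have := hx n; rewrite /e big_nat_recr//= ipDr ip_sumr big_nat_cond big1 =>
  [|i /andP[/andP[_ im] _]].
  by rewrite add0r ipZr => /eqP;
    rewrite mulf_eq0 conjs_eq0 (negPf (cn n)) => /eqP.
by rewrite ipZr IH// mulr0.
Qed.

(** The operator is [x |-> sum_n <x,g_n> v_n]; [coef_sqsum_bound] makes this
    series converge and bounds its sum. *)
Lemma basis_extension (v : nat -> H) D : 0 <= D ->
  (forall m n (c : nat -> K), normR (\sum_(m <= i < n) c i *: v i) ^+ 2 <=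
     D * \sum_(m <= i < n) absR (c i) ^+ 2 * normR (f i) ^+ 2) ->
  exists B : {linear H -> H}, bounded_operator B /\ forall n, B (f n) = v n.
Proof.
move=> D0 hD; have [C C0 hC] := coef_sqsum_bound Hip fg fcvg.
have bnd x n : normR (\sum_(0 <= i < n) ip x (g i) *: v i) ^+ 2 <=
    D * C * normR x ^+ 2.
  by apply: le_trans (hD _ _ _) _; rewrite -mulrA ler_wpM2l.
have /choice[T hT] : forall x, exists y : H,
    series (fun n => ip x (g n) *: v n) @ \oo --> y.
  move=> x; apply: (cvg_dominated
    (b := fun i => D * (absR (ip x (g i)) ^+ 2 * normR (f i) ^+ 2))
     (C := D * (C * normR x ^+ 2))) => [m n _|n].
    by rewrite -mulr_sumr.
  by rewrite -mulr_sumr ler_wpM2l.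
have Tlin : linear T.
  move=> a x y; apply: (seq_cvg_unique (hT _)).
  have -> : series (fun n => ip (a *: x + y) (g n) *: v n) =
     (fun n => a *: series (fun n => ip x (g n) *: v n) n +
       series (fun n => ip y (g n) *: v n) n).
    apply/funext => n; rewrite /series /= scaler_sumr -big_split /=.
    by apply: eq_bigr => i _; rewrite ipDl ipZl scalerDl scalerA.
  by apply: cvgD => //; apply: cvgZr.
pose B : {linear H -> H} := HB.pack T (GRing.isLinear.Build _ _ _ _ T Tlin).
exists B; split.
  exists (Num.sqrt (D * C)) => x; apply: (cvg_normR_le (hT x));
    exists 0%N => n _.
  rewrite -(@ler_pXn2r _ 2%N)// ?nnegrE ?mulr_ge0 ?sqrtr_ge0 ?normR_ge0//.
  by rewrite exprMn sqr_sqrtr ?mulr_ge0 ?(ltW C0)//; exact: bnd.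
move=> n; apply: (seq_cvg_unique (hT _)); apply/cvgR => e e0;
  exists n.+1 => m nm.
suff -> : series (fun i => ip (f n) (g i) *: v i) m = v n
  by rewrite subrr normR0.
rewrite /series /=; under eq_bigr do rewrite fg eq_sym scaler_nat mulrb.
by rewrite -big_mkcond big_nat1_eq /= nm.
Qed.

(** The inner product being continuous, applying [B] to the expansion of [x]
    shows that the coordinates of [B x] in [e] are those of [x] in [f]. *)
Lemma coef_of_image (B : {linear H -> H}) e x n : bounded_operator B ->
  orthonormal_basis ip e -> (forall n, B (f n) = e n) ->
  ip (B x) (e n) = ip x (g n).
Proof.
move=> [M hM] [ee _] Bf; have [hx _] := fcvg x.
apply: (cvg_ip_const Hip (bounded_cvg hM hx)); exists n.+1 => m nm.
rewrite /= /series linear_sum; under eq_bigr do rewrite linearZ Bf.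
by rewrite (coef_basis_sum ee) nm.
Qed.

End Basis.
End Orthonormal.

(** * Images of the basis and the size of its vectors *)

Section Classification.
Variables (R : realType) (k : scalar_kind).
Local Notation K := (scalars R k).
Variable H : completeNormedModType K.
Variable ip : {dot H for conjs R k}.
Hypothesis Hip : ip_induces_norm ip.

Lemma biorthogonal_normR e n : biorthogonal ip e e -> normR (e n) = 1.
Proof.
move=> ee; have := ee n n;
  rewrite (ipxx Hip) eqxx -(emb1 R k) => /(can_inj (@embK R k))/eqP.
by rewrite sqrf_eq1 => /orP[/eqP//|/eqP h]; have := normR_ge0 (e n); lra.
Qed.

(** The usual duality between synthesis and analysis: with
    [u = sum_i <x,h_i> h_i] and [s] the sum of squares, [s = <x,u>], so
    [s^2 <= |x|^2 |u|^2 <= |x|^2 D s]. *)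
Lemma Bessel_of_synthesis (h : nat -> H) D x n : 0 <= D ->
  normR (\sum_(0 <= i < n) ip x (h i) *: h i) ^+ 2 <=
    D * \sum_(0 <= i < n) absR (ip x (h i)) ^+ 2 ->
  \sum_(0 <= i < n) absR (ip x (h i)) ^+ 2 <= D * normR x ^+ 2.
Proof.
set s := \sum_(_ <= _ < _) _ ^+ 2; set u := \sum_(_ <= _ < _) _ => D0 hD.
have s0 : 0 <= s by rewrite sumr_ge0// => i _; rewrite sqr_ge0.
have sE : ip x u = emb s.
  rewrite (big_morph _ (@embD R k) (emb0 R k)) ip_sumr; apply: eq_bigr => i _.
  by rewrite ipZr mulrC mul_conjs.
have := Cauchy_Schwarz Hip x u; rewrite sE absR_emb ger0_norm// => su.
have {su}su : s ^+ 2 <= normR x ^+ 2 * (D * s).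
  apply: (@le_trans _ _ ((normR x * normR u) ^+ 2)).
    by rewrite ler_pXn2r// nnegrE mulr_ge0 ?normR_ge0.
  by rewrite exprMn ler_wpM2l ?sqr_ge0.
move: s0; rewrite le_eqVlt => /orP[/eqP <-|s0];
  first by rewrite mulr_ge0 ?sqr_ge0.
by rewrite -(ler_pM2r s0) -expr2; apply: le_trans su _; rewrite mulrCA mulrA.
Qed.

Section RankedMask.
Variables (e : nat -> H) (S : pred nat).
Hypothesis onb : orthonormal_basis ip e.

Let r n := count S (iota 0 n).
(** An orthonormal basis reindexed by the set [S], completed by zeros: since [r]
    enumerates [S], each [e j] occurs exactly once when [S] is infinite. *)
Definition ranked_mask n : H := if S n then e (r n) else 0.

Let rS n : r n.+1 = (r n + S n)%N.
Proof. by rewrite /r -addn1 iotaD count_cat /= addn0. Qed.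

Let r_mono : {homo r : m n / (m <= n)%N}.
Proof. by apply: homo_leq => // [i j l|j];
  [exact: leq_trans|rewrite rS leq_addr]. Qed.

Lemma ranked_mask_orthogonal i n : (i < n)%N ->
  ip (ranked_mask i) (ranked_mask n) = 0.
Proof.
rewrite /ranked_mask => ilt; case: ifP => Si; last by rewrite ip0l.
case: ifP => Sn; last by rewrite ip0r.
by rewrite onb.1 ltn_eqF// (leq_trans _ (r_mono ilt))// rS Si addn1.
Qed.

Lemma normR_ranked_mask_sum m n (c : nat -> K) :
  normR (\sum_(m <= i < n) c i *: ranked_mask i) ^+ 2 =
    \sum_(m <= i < n | S i) absR (c i) ^+ 2.
Proof.
rewrite [RHS]big_mkcond.
have [nm|mn] := leqP n m; first by rewrite !big_geq// normR0 expr0n.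
elim: n mn => [//|n IH]; rewrite ltnS leq_eqVlt => /orP[/eqP ->|mn].
  rewrite !big_nat1 normRZ exprMn /ranked_mask; case: ifP => _.
    by rewrite (biorthogonal_normR _ onb.1) expr1n mulr1.
  by rewrite normR0 expr0n mulr0.
rewrite !big_nat_recr ?(ltnW mn)//= (normRD_sqr Hip) IH//.
have -> : ip (\sum_(m <= i < n) c i *: ranked_mask i) (c n *: ranked_mask n)
  = 0.
  rewrite ip_suml big_nat_cond big1// => i /andP[/andP[_ ilt] _].
  by rewrite ipZl ipZr ranked_mask_orthogonal// !mulr0.
rewrite res0 mulr0 addr0; congr (_ + _).
rewrite normRZ exprMn /ranked_mask; case: ifP => _.
  by rewrite (biorthogonal_normR _ onb.1) expr1n mulr1.
by rewrite normR0 expr0n mulr0.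
Qed.

Lemma ranked_mask_coef x n :
  \sum_(0 <= i < n) absR (ip x (ranked_mask i)) ^+ 2 =
  \sum_(0 <= i < r n) absR (ip x (e i)) ^+ 2.
Proof.
elim: n => [|n IH]; first by rewrite !big_geq.
rewrite big_nat_recr//= IH rS /ranked_mask; case: ifP => _.
  by rewrite addn1 big_nat_recr.
by rewrite ip0r absR0 expr0n addr0 addn0.
Qed.

Lemma ranked_mask_Parseval : (forall N, exists2 n, (N <= n)%N & S n) ->
  Parseval_frame ip ranked_mask.
Proof.
move=> Sinf x.
have rinf m : exists n, (m <= r n)%N.
  elim: m => [|m [n mn]]; first by exists 0%N.
  have [n' nn' Sn'] := Sinf n; exists n'.+1.
  by rewrite rS Sn' addn1 ltnS (leq_trans mn)// r_mono.
apply/eqP; rewrite eq_le; apply/andP; split.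
  by apply/coef_sqsum_le => n; rewrite ranked_mask_coef; apply: Bessel => //;
    exact: onb.1.
apply: coef_sqsum_ge => C hC; apply: (Parseval_le Hip onb.1 onb) => m.
have [n mn] := rinf m; have := hC n; rewrite ranked_mask_coef; apply: le_trans.
rewrite [leRHS](@big_cat_nat _ _ _ m)//= lerDl sumr_ge0// => i _.
by rewrite sqr_ge0.
Qed.
End RankedMask.

Lemma ranked_mask_predT e : ranked_mask e predT = e.
Proof. by apply/funext => n; rewrite /ranked_mask /= count_predT size_iota. Qed.

Section Basis.
Variables f g : nat -> H.
Hypothesis fg : biorthogonal ip f g.
Hypothesis fcvg :
  forall x, unconditionally_cvg_to (fun n => ip x (g n) *: f n) x.

(** On [S] the norms of the [f n] are bounded below, so the coefficients there
    are square summable. *)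
Lemma basis_to_ranked_mask e (S : pred nat) d : orthonormal_basis ip e ->
  0 < d -> (forall n, S n -> d <= normR (f n)) ->
  exists B : {linear H -> H}, bounded_operator B /\
    forall n, B (f n) = ranked_mask e S n.
Proof.
move=> onb d0 hS; have d2 : 0 < d ^+ 2 by rewrite exprn_gt0.
apply: (basis_extension Hip fg fcvg (D := (d ^+ 2)^-1));
  first by rewrite invr_ge0 ltW.
move=> m n c; rewrite normR_ranked_mask_sum// ler_pdivlMl// mulr_sumr
  big_mkcond /=.
apply: ler_sum => i _; case: ifP => Si; last by rewrite mulr_ge0 ?sqr_ge0.
rewrite mulrC ler_wpM2l ?sqr_ge0// ler_pXn2r ?nnegrE ?(ltW d0) ?normR_ge0//.
exact: hS.
Qed.

(** Norms that do not tend to zero stay above some [d > 0] on an infinite set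
    [S]; the [f n] with [n] in [S] are sent to an orthonormal basis, the others
    to zero. *)
Lemma CFC_of_not_cvg0 :
  ~ ((fun n => normR (f n)) @ \oo --> (0 : R)) -> CFC ip f.
Proof.
move=> hn.
have [d d0 hd] : exists2 d : R, 0 < d &
    forall N, exists2 n, (N <= n)%N & d <= normR (f n).
  apply: contrapT => /forall2NP h; apply: hn; apply/cvgrPdist_lt => d d0.
  have [//|] := h d; move=> /existsNP[N hN]; exists N => // n Nn.
  rewrite /= sub0r normrN ger0_norm ?normR_ge0// ltNge; apply/negP => dn.
  by apply: hN; exists n.
have [e onb] := orthonormal_basis_ex Hip fg fcvg.
pose S n := d <= normR (f n).
have [//|B [hB Bf]] := basis_to_ranked_mask (S := S) onb d0.
exists B; split=> //; have -> : B \o f = ranked_mask e S by apply/funext.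
exact: ranked_mask_Parseval.
Qed.

(** The synthesis operator of [B \o f] is bounded after a diagonal operator with
    entries [|f_n|], so it is compact when these tend to zero, whereas that of a
    Parseval frame is a coisometry. Concretely, a unit vector [x] orthogonal to
    [B f_0, ..., B f_N.-1] only sees the vectors with small [|f_n|], and
    [Bessel_of_synthesis] bounds its sum of squares by one half instead of 1. *)
Lemma not_CFC_of_cvg0 : (fun n => normR (f n)) @ \oo --> (0 : R) -> ~ CFC ip f.
Proof.
move=> f0 [B [[M hM] PF]].
have [C C0 hC] := Kothe_Toeplitz Hip fg fcvg.
pose D := (`|M| + 1) ^+ 2 * C.
have D0 : 0 < D by rewrite mulr_gt0// exprn_gt0// ltr_pwDr.
pose q : R := (2 * D)^-1.
have q0 : 0 < q by rewrite invr_gt0 mulr_gt0.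
have [N hN] : exists N, forall n, (N <= n)%N -> normR (f n) ^+ 2 <= q.
  have /cvgrPdist_lt/(_ (Num.sqrt q)) := f0;
    rewrite sqrtr_gt0 => /(_ q0)[N _ hN].
  exists N => n Nn; have := hN n Nn;
    rewrite /= sub0r normrN ger0_norm ?normR_ge0// => /ltW h.
  by rewrite -(sqr_sqrtr (ltW q0)) ler_pXn2r ?nnegrE ?sqrtr_ge0 ?normR_ge0.
have [c [x1 xB]] := exists_unit_orthogonal (B \o f) N fg.
move: (\sum_(_ <= _ < _) _) x1 xB => x x1 xB {c}.
suff /coef_sqsum_le : forall n,
    \sum_(0 <= i < n) absR (ip x ((B \o f) i)) ^+ 2 <= 2^-1.
  by rewrite PF x1 expr1n lee_fin => h; lra.
move=> n; have -> : 2^-1 = 2^-1 * normR x ^+ 2 by rewrite x1 expr1n mulr1.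
apply: Bessel_of_synthesis.
  by rewrite invr_ge0.
have -> : \sum_(0 <= i < n) ip x ((B \o f) i) *: (B \o f) i =
    B (\sum_(0 <= i < n) ip x ((B \o f) i) *: f i).
  by rewrite linear_sum; apply: eq_bigr => i _; rewrite linearZ.
set u := \sum_(_ <= _ < _) _ *: _.
apply: (@le_trans _ _ ((`|M| + 1) ^+ 2 * normR u ^+ 2)).
  rewrite -exprMn ler_pXn2r ?nnegrE ?mulr_ge0 ?addr_ge0 ?normR_ge0//.
  apply: le_trans (hM _) _; rewrite ler_wpM2r ?normR_ge0//.
  by apply: le_trans (ler_norm _) _; rewrite lerDl.
have -> : 2^-1 = D * q by rewrite /q invfM mulrCA mulfV ?mulr1// gt_eqF.
rewrite -[leRHS]mulrA -[leRHS]mulrA ler_wpM2l ?exprn_ge0 ?addr_ge0//.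
apply: le_trans (hC 0%N n (fun i => ip x ((B \o f) i))).1 _;
  rewrite ler_wpM2l ?(ltW C0)// mulr_sumr.
apply: ler_sum_nat => i _; rewrite mulrC.
have [iN|Ni] := ltnP i N; first by rewrite xB// absR0 expr0n !mulr0.
by rewrite ler_wpM2r ?sqr_ge0// hN.
Qed.

(** [coef_of_image]: the coefficients of [x] can be read off [B x]. *)
Lemma CO_injective (B : {linear H -> H}) : bounded_operator B ->
  orthonormal_basis ip (B \o f) -> injective B.
Proof.
move=> hB onb x y Bxy; apply/eqP; rewrite -subr_eq0; apply/eqP.
apply: (coef_eq0 fcvg) => n.
rewrite -(coef_of_image Hip fcvg _ _ hB onb)// linearB Bxy subrr.
exact: ip0l.
Qed.

(** [1 = |B f_n| <= M |f_n|]. *)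
Lemma CO_bounded_below : CO ip f ->
  exists2 d : R, 0 < d & forall n, d <= normR (f n).
Proof.
move=> [B [[M hM] [ee _]]].
have h n : 1 <= M * normR (f n) by rewrite -(biorthogonal_normR n ee) hM.
have M0 : 0 < M.
  by rewrite ltNge; apply/negP => M0; have := h 0%N; have := normR_ge0 (f 0%N);
    nra.
by exists M^-1 => [|n]; rewrite ?invr_gt0// -[leLHS]mulr1 ler_pdivrMl.
Qed.

Lemma CO_of_bounded_below d : 0 < d -> (forall n, d <= normR (f n)) -> CO ip f.
Proof.
move=> d0 hd; have [e onb] := orthonormal_basis_ex Hip fg fcvg.
have [//|B [hB Bf]] := basis_to_ranked_mask (S := predT) onb d0.
exists B; split=> //; have -> // : B \o f = e.
by rewrite -(ranked_mask_predT e); apply/funext.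
Qed.

(** If [|f_(n_j)| > 2^j (j + 1)] for all [j], the vector
    [y = sum_j 2^-j e_(n_j)] has no preimage [x]: the coefficients of [x] would
    satisfy [|<x,g_(n_j)>| >= 2^-j], making [|<x,g_n>| |f_n|] unbounded. The
    indices [n_j] may repeat, which only increases the coefficients. *)
Lemma SCO_bounded_above : SCO ip f -> exists L : R, forall n, normR (f n) <= L.
Proof.
move=> [B [hB surj onb]]; apply: contrapT => /forallNP unb.
have /choice[n_ hn] : forall j, exists n, 2 ^+ j * j.+1%:R < normR (f n).
  by move=> j; have /existsNP[n /negP] := unb (2 ^+ j * j.+1%:R);
    rewrite -ltNge; exists n.
pose e := B \o f.
have [ee _] := onb.
have [y hy] : exists y : H,
    series (fun j => emb (2^-1 ^+ j) *: e (n_ j)) @ \oo --> y.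
  apply: geometric_cvg => j;
    rewrite normRZ (biorthogonal_normR _ ee) mulr1 absR_emb.
  by rewrite ger0_norm// exprn_ge0// invr_ge0.
have [x Bx] := surj y.
have xg j : 2^-1 ^+ j <= absR (ip x (g (n_ j))).
  rewrite -(coef_of_image Hip fcvg _ _ hB onb)// Bx;
    apply: le_trans (ler_res _).
  rewrite -lerN2 -resN;
    have <- : ip y (- e (n_ j)) = - ip y (e (n_ j)) by exact: linearNr.
  apply: (cvg_res_ip_le Hip hy); exists j.+1 => m jm.
  have -> : ip (series (fun j => emb (2^-1 ^+ j) *: e (n_ j)) m) (- e (n_ j)) =
     - emb (\sum_(0 <= i < m) 2^-1 ^+ i * (n_ i == n_ j)%:R).
    rewrite (linearNr ip) /series /= ip_suml.
    rewrite (big_morph _ (@embD R k) (emb0 R k)).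
    congr (- _); apply: eq_bigr => i _; rewrite ipZl ee embM; congr (_ * _).
    by case: eqP => _; rewrite ?emb0 ?emb1.
  have jin : j \in index_iota 0 m by rewrite mem_index_iota.
  rewrite resN embK lerN2 (big_rem j jin) /= eqxx mulr1 lerDl.
  by rewrite sumr_ge0.
have [C C0 hC] := coef_sqsum_bound Hip fg fcvg.
have h j : j.+1%:R ^+ 2 <= C * normR x ^+ 2.
  apply: le_trans (hC x (n_ j).+1); rewrite big_nat_recr//= -exprMn.
  apply: (@le_trans _ _ ((absR (ip x (g (n_ j))) * normR (f (n_ j))) ^+ 2));
    last first.
    by rewrite lerDr sumr_ge0// => i _; rewrite mulr_ge0 ?sqr_ge0.
  rewrite ler_pXn2r ?nnegrE ?mulr_ge0 ?absR_ge0 ?normR_ge0//.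
  have -> : j.+1%:R = 2^-1 ^+ j * (2 ^+ j * j.+1%:R) :> R.
    by rewrite mulrA -exprMn mulVf// expr1n mul1r.
  by apply: ler_pM; rewrite ?mulr_ge0 ?exprn_ge0 ?invr_ge0// ?xg// ltW.
have := h (Num.bound (C * normR x ^+ 2)); apply/negP; rewrite -ltNge.
set T := C * _; have T0 : 0 <= T by rewrite mulr_ge0 ?sqr_ge0// ltW.
apply: (lt_le_trans (archi_boundP T0)).
by rewrite -natrX ler_nat expnS expn1; nia.
Qed.

(** The norms of the [f n] lie between positive constants, so [Kothe_Toeplitz]
    bounds both the synthesis operator of [f], which gives the upper frame bound
    by duality, and the coefficients in [f]. For the lower bound,
    [|x|^2 = sum_n <x,g_n> <f_n,x>], and the arithmetic-geometric inequality
    absorbs the coefficients [<x,g_n>] into half of [|x|^2]. *)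
Lemma Riesz_basis_of_SCO : SCO ip f -> Riesz_basis ip f.
Proof.
move=> hS; split; last by exists g.
have [L hL] := SCO_bounded_above hS.
have [d d0 hd] : exists2 d : R, 0 < d & forall n, d <= normR (f n).
  by apply: CO_bounded_below; have [B [hB _ onb]] := hS; exists B.
have [C C0 hC] := Kothe_Toeplitz Hip fg fcvg.
have [C' C'0 hC'] := coef_sqsum_bound Hip fg fcvg.
have L0 : 0 < L by apply: lt_le_trans d0 (le_trans (hd 0%N) (hL _)).
pose Q := C' / d ^+ 2.
have d2 : 0 < d ^+ 2 by rewrite exprn_gt0.
have Q0 : 0 < Q by rewrite divr_gt0.
have gQ x n : \sum_(0 <= i < n) absR (ip x (g i)) ^+ 2 <= Q * normR x ^+ 2.
  rewrite /Q mulrAC ler_pdivlMr//; apply: le_trans (hC' x n); rewrite mulr_suml.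
  apply: ler_sum => i _; rewrite ler_wpM2l ?sqr_ge0//.
  by rewrite ler_pXn2r ?nnegrE ?(ltW d0) ?normR_ge0.
exists Q^-1, (C * L ^+ 2); split;
  [by rewrite invr_gt0|by rewrite mulr_gt0 ?exprn_gt0|move=> x; split].
  apply: coef_sqsum_ge => T hT; rewrite ler_pdivrMl//.
  suff : normR x ^+ 2 <= 2^-1 * normR x ^+ 2 + 2^-1 * (Q * T) by lra.
  have [hx _] := fcvg x.
  rewrite -[leLHS](@embK R k) -(ipxx Hip); apply: (cvg_res_ip_le Hip hx).
  exists 0%N => n _; rewrite /series /= ip_suml.
  rewrite (big_morph _ (@resD R k) (res0 R k)).
  apply: (@le_trans _ _ (\sum_(0 <= i < n)
      (2^-1 * (Q^-1 * absR (ip x (g i)) ^+ 2) +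
      2^-1 * (Q * absR (ip x (f i)) ^+ 2)))).
    apply: ler_sum => i _; rewrite ipZl; apply: le_trans (ler_res _) _.
    rewrite absRM (absR_ipC ip (f i)); set a := absR _; set b := absR _.
    have : 0 <= Q^-1 * (a - Q * b) ^+ 2
      by rewrite mulr_ge0 ?sqr_ge0// invr_ge0 ltW.
    have -> : Q^-1 * (a - Q * b) ^+ 2 =
        Q^-1 * a ^+ 2 + Q * b ^+ 2 - 2 * (a * b).
      by field; rewrite gt_eqF.
    by move: (Q^-1 * a ^+ 2) (Q * b ^+ 2) (a * b) => p q s; lra.
  rewrite big_split -!mulr_sumr /=; apply: lerD.
    by rewrite ler_pM2l ?invr_gt0// ler_pdivrMl// gQ.
  by rewrite ler_pM2l ?invr_gt0// ler_pM2l// hT.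
apply/coef_sqsum_le => n; apply: Bessel_of_synthesis.
  by rewrite mulr_ge0 ?sqr_ge0// ltW.
apply: le_trans (hC _ _ _).1 _; rewrite -mulrA ler_pM2l// mulr_sumr.
apply: ler_sum => i _; rewrite mulrC ler_wpM2r ?sqr_ge0//.
by rewrite ler_pXn2r ?nnegrE ?(ltW L0) ?normR_ge0.
Qed.

(** The upper frame bound tested on [f n] gives [|f_n|^2 <= D]; the lower one
    tested on [h n] gives [A |h_n|^2 <= 1], whence [A <= |f_n|^2] as
    [<f_n,h_n> = 1]. The operator of [CO_of_bounded_below] is onto because
    square summable coefficients can be synthesised in [f]. *)
Lemma SCO_of_Riesz_basis : Riesz_basis ip f -> SCO ip f.
Proof.
move=> [[A [D [A0 D0 hAD]]] [h fh]].
have up n : normR (f n) ^+ 2 <= D.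
  have /coef_sqsum_le/(_ n.+1) := (hAD (f n)).2; rewrite big_nat_recr//= => hn.
  have : absR (ip (f n) (f n)) ^+ 2 <= D * normR (f n) ^+ 2.
    by apply: le_trans hn; rewrite lerDr sumr_ge0// => i _; rewrite sqr_ge0.
  rewrite (ipxx Hip) absR_emb ger0_norm ?sqr_ge0// expr2 ler_pM2r//.
  rewrite exprn_gt0// lt_neqAle normR_ge0 andbT eq_sym;
    apply/eqP => /normR_eq0 f0.
  have := fh n n; rewrite f0 ip0l eqxx => /eqP; rewrite eq_sym;
    exact/negP/oner_neq0.
have low n : A <= normR (f n) ^+ 2.
  have hA : A * normR (h n) ^+ 2 <= 1.
    rewrite -lee_fin; apply: le_trans (hAD (h n)).1 _; apply/coef_sqsum_le => m.
    under eq_bigr do rewrite absR_ipC fh -[_%:R]/(_%:R).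
    rewrite (_ : \sum_(0 <= i < m) _ =
        \sum_(0 <= i < m) (if i == n then 1 else 0)).
      by rewrite -big_mkcond big_nat1_eq; case: ifP.
    apply: eq_bigr => i _; case: eqP => _; last by rewrite absR0 expr0n.
    by rewrite -(emb1 R k) absR_emb normr1 expr1n.
  have := Cauchy_Schwarz Hip (f n) (h n).
  rewrite fh eqxx -(emb1 R k) absR_emb normr1 => h1.
  have : 1 <= normR (f n) ^+ 2 * normR (h n) ^+ 2.
    by rewrite -exprMn -(expr1n R 2) ler_pXn2r// nnegrE ?mulr_ge0 ?normR_ge0.
  move=> h2; have := ler_wpM2l (ltW A0) h2; rewrite mulr1 => h3;
    apply: le_trans h3 _.
  rewrite mulrCA -[leRHS]mulr1; apply: ler_wpM2l hA; exact: sqr_ge0.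
have [//||B [hB onb]] := @CO_of_bounded_below (Num.sqrt A).
- by rewrite sqrtr_gt0.
- by move=> n; rewrite -(@ler_pXn2r _ 2%N)// ?nnegrE ?sqrtr_ge0 ?normR_ge0//
  sqr_sqrtr// ltW.
exists B; split=> // y.
have [C C0 hC] := Kothe_Toeplitz Hip fg fcvg.
have [x hx] : exists x : H, series (fun n => ip y (B (f n)) *: f n) @ \oo --> x.
  apply: (cvg_dominated (b := fun n => C * (D * absR (ip y (B (f n))) ^+ 2))
     (C := C * (D * normR y ^+ 2))) => [m n _|n].
    apply: le_trans (hC _ _ _).1 _; rewrite -mulr_sumr ler_pM2l//.
    by apply: ler_sum => i _; rewrite mulrC ler_wpM2r ?sqr_ge0.
  rewrite -!mulr_sumr !ler_pM2l//.
  by have := Bessel Hip onb.1 y n.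
exists x; have [M hM] := hB.
apply: (seq_cvg_unique (bounded_cvg hM hx)).
suff -> : B \o series (fun n => ip y (B (f n)) *: f n) =
    series (fun n => ip y ((B \o f) n) *: (B \o f) n) by exact: onb.2.
apply/funext => n; rewrite /= /series linear_sum.
by apply: eq_bigr => i _; rewrite linearZ.
Qed.

Lemma bounded_belowP : (exists2 d : R, 0 < d & forall n, d <= normR (f n)) <->
  0 < inf (range (fun n => normR (f n))).
Proof.
set A := range _; have A0 : has_inf A.
  by split; [exists (normR (f 0%N)), 0%N|exists 0 => _ [n _ <-];
    exact: normR_ge0].
split=> [[d d0 hd]|i0]; last first.
  by exists (inf A) => // n; apply: (ge_inf A0.2); exists n.
by apply: lt_le_trans d0 _; apply: (lb_le_inf A0.1) => _ [n _ <-]; exact: hd.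
Qed.

End Basis.
End Classification.

(** * The classification *)

Theorem theorem5p1 (R : realType) (k : scalar_kind)
    (H : completeNormedModType (scalars R k)) (ip : {dot H for conjs R k})
    (Hip : ip_induces_norm ip)
    (Hsep : separable_space H) (Hinf : ~ finite_dimensional H)
    (f : nat -> H) (Hf : unconditional_Schauder_basis ip f) :
  (~ CFC ip f <-> (fun n => normR (f n)) @ \oo --> (0 : R)) /\
  ((CO ip f <-> ICO ip f) /\
   (ICO ip f <-> 0 < inf (range (fun n => normR (f n))))) /\
  (SCO ip f <-> Riesz_basis ip f).
Proof.
have [g fg fcvg] := Hf.
have CO_ICO : CO ip f <-> ICO ip f.
  split=> [[B [hB onb]]|[B [hB _ onb]]]; last by exists B.
  by exists B; split=> //; exact: (CO_injective Hip fcvg hB onb).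
split; [split|split; [split=> //|split]].
- by move=> nCFC; apply: contrapT => /(CFC_of_not_cvg0 Hip fg fcvg).
- exact: (not_CFC_of_cvg0 Hip fg fcvg).
- rewrite -CO_ICO -bounded_belowP; split; first exact: (CO_bounded_below Hip).
  by move=> [d d0 hd]; exact: (CO_of_bounded_below Hip fg fcvg d0 hd).
- exact: (Riesz_basis_of_SCO Hip fg fcvg).
- exact: (SCO_of_Riesz_basis Hip fg fcvg).
Qed.
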